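(* Consider the cubic homogeneous polynomial differential system $$\dot x=-y(3x^2+y^2),\qquad \dot y=x(x^2-y^2),$$ which has a global center at the origin, and its perturbations inside the class of all cubic polynomial differential systems $$ \begin{aligned} \dot{x}&=-y(3x^2+y^2)+\varepsilon \sum_{0\leq i+j\leq 3}a_{ij}x^iy^{j}+\varepsilon^2 \sum_{0\leq i+j\leq 3}b_{ij}x^iy^{j},\\ \dot{y}&=x(x^2-y^2)+\varepsilon\sum_{0\leq i+j\leq 3}c_{ij}x^iy^{j}+\varepsilon^2 \sum_{0\leq i+j\leq 3}d_{ij}x^iy^{j}, \end{aligned} $$ with real coefficients $a_{ij},b_{ij},c_{ij},d_{ij}$ and $\varepsilon$ a small real parameter. Using averaging theory of second order (in the sense defined in the context), at most three limit cycles of the perturbed system bifurcate from the periodic orbits of the center of the unperturbed system. Moreover, there are examples with 3, 2, 1 and 0 limit cycles. Explicitly, with $G_{10}$ and $G_{20}$ as defined in the context: for every choice of real coefficients $a_{ij},b_{ij},c_{ij},d_{ij}$ such that $G_{10}\equiv 0$ and $G_{20}\not\equiv 0$ on $(0,\infty)$, the function $G_{20}$ has at most three simple zeros in $(0,\infty)$; and for each $k\in\{0,1,2,3\}$ there is a choice of real coefficients such that $G_{10}\equiv 0$, $G_{20}\not\equiv0$ and exactly $k$ limit cycles bifurcate from the periodic orbits of the center using averaging theory of second order, i.e. $G_{20}$ has exactly $k$ simple zeros in $(0,\infty)$.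
   Context: A center is a singular point having a neighborhood filled with periodic orbits, with the unique exception of the singular point; it is global if all orbits in $\mathbb{R}^2\setminus\{(0,0)\}$ are periodic. A limit cycle is a periodic orbit isolated in the set of all periodic orbits of the system. In polar coordinates $x=r\cos\theta$, $y=r\sin\theta$, $r>0$, the perturbed system gives, after dividing $\dot r$ by $\dot\theta$ and expanding in powers of $\varepsilon$, the equation $$\frac{dr}{d\theta}=G_0(\theta,r)+\varepsilon G_1(\theta,r)+\varepsilon^2G_2(\theta,r)+O(\varepsilon^3),\qquad G_0(\theta,r)=-2r\cos\theta\sin\theta,$$ which defines $G_1$ and $G_2$ ($2\pi$-periodic in $\theta$). The solution of the unperturbed equation ($\varepsilon=0$) with $r_s(0,r_0)=r_0$ is $r_s(\theta,r_0)=r_0e^{-\sin^2\theta}$, which is $2\pi$-periodic for every $r_0\in(0,\infty)$. The solution of the variational equation $\partial u/\partial\theta=\frac{\partial G_0}{\partial r}(\theta,r_s(\theta,r_0))\,u$ with $u(0,r_0)=1$ is $u(\theta,r_0)=e^{-\sin^2\theta}$. For $r_0\in(0,\infty)$ define $$u_1(\theta,r_0)=\int_0^\theta\frac{G_1(\phi,r_s(\phi,r_0))}{u(\phi,r_0)}\,d\phi,\qquad G_{10}(r_0)=\int_0^{2\pi}\frac{G_1(\theta,r_s(\theta,r_0))}{u(\theta,r_0)}\,d\theta,$$ $$G_{20}(r_0)=\int_0^{2\pi}\left(\frac{G_2(\theta,r_s(\theta,r_0))}{u(\theta,r_0)}+\frac{\partial G_1}{\partial r}(\theta,r_s(\theta,r_0))\,u_1(\theta,r_0)+\frac12\frac{\partial^2G_0}{\partial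 r^2}(\theta,r_s(\theta,r_0))\,u_1(\theta,r_0)^2\right)d\theta$$ (here $\partial^2G_0/\partial r^2=0$, so the last term vanishes). Averaging theory of second order: assume $G_{10}\equiv0$ and $G_{20}\not\equiv0$ on $(0,\infty)$. Then for each simple zero $r^*\in(0,\infty)$ of $G_{20}$ there exists, for $|\varepsilon|\neq0$ small enough, a periodic solution $r_\varepsilon(\theta)$ of the equation for $dr/d\theta$ with $r_\varepsilon(0)\to r^*$ as $\varepsilon\to0$. The limit cycles bifurcating from the periodic orbits of the center ''using averaging theory of second order'' are those obtained in this way, one for each simple zero of $G_{20}$ in $(0,\infty)$, for coefficients with $G_{10}\equiv0$ and $G_{20}\not\equiv0$. *)

(* Defs.v *)
From Stdlib Require Import Reals Lra List Factorial.
From Coquelicot Require Import Coquelicot.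
Open Scope R_scope.

(* Nonconstancy of the solution is what excludes singular points. *)
Definition on_periodic_orbit (X Y : R -> R -> R) (x0 y0 : R) : Prop :=
  exists (T : R) (x y : R -> R),
    0 < T /\ x 0 = x0 /\ y 0 = y0 /\
    (forall t, is_derive x t (X (x t) (y t))) /\
    (forall t, is_derive y t (Y (x t) (y t))) /\
    (forall t, x (t + T) = x t /\ y (t + T) = y t) /\
    (exists t, x t <> x0 \/ y t <> y0).

Definition center_at_origin (X Y : R -> R -> R) : Prop :=
  X 0 0 = 0 /\ Y 0 0 = 0 /\
  exists delta, 0 < delta /\
    forall x0 y0, 0 < x0 ^ 2 + y0 ^ 2 < delta ^ 2 ->
      on_periodic_orbit X Y x0 y0.

Definition global_center_at_origin (X Y : R -> R -> R) : Prop :=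
  center_at_origin X Y /\
  forall x0 y0, (x0, y0) <> (0, 0) -> on_periodic_orbit X Y x0 y0.

Definition X0 (x y : R) : R := - y * (3 * x ^ 2 + y ^ 2).
Definition Y0 (x y : R) : R := x * (x ^ 2 - y ^ 2).

(* The sum over 0 <= i + j <= 3; [sum_f_R0 f n] has the n + 1 terms
   f 0, ..., f n.  The values p i j with i + j > 3 play no role. *)
Definition cubic (p : nat -> nat -> R) (x y : R) : R :=
  sum_f_R0 (fun i => sum_f_R0 (fun j => p i j * x ^ i * y ^ j) (3 - i)) 3.

Definition Xeps (a b : nat -> nat -> R) (eps x y : R) : R :=
  X0 x y + eps * cubic a x y + eps ^ 2 * cubic b x y.
Definition Yeps (c d : nat -> nat -> R) (eps x y : R) : R :=
  Y0 x y + eps * cubic c x y + eps ^ 2 * cubic d x y.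

Definition rdot (a b c d : nat -> nat -> R) (eps theta r : R) : R :=
  cos theta * Xeps a b eps (r * cos theta) (r * sin theta)
  + sin theta * Yeps c d eps (r * cos theta) (r * sin theta).

Definition thetadot (a b c d : nat -> nat -> R) (eps theta r : R) : R :=
  (cos theta * Yeps c d eps (r * cos theta) (r * sin theta)
   - sin theta * Xeps a b eps (r * cos theta) (r * sin theta)) / r.

(* Coefficient of eps^k in the Taylor expansion of dr/dtheta at eps = 0; for
   r > 0 the denominator is r^2 at eps = 0, see [thetadot_unperturbed]. *)
Definition G (a b c d : nat -> nat -> R) (k : nat) (theta r : R) : R :=
  Derive_n (fun eps => rdot a b c d eps theta r / thetadot a b c d eps theta r) k 0
  / INR (fact k).

Definition r_s (theta r0 : R) : R := r0 * exp (- (sin theta) ^ 2).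

Definition u (theta r0 : R) : R := exp (- (sin theta) ^ 2).

Definition u_1 (a b c d : nat -> nat -> R) (theta r0 : R) : R :=
  RInt (fun phi => G a b c d 1 phi (r_s phi r0) / u phi r0) 0 theta.

Definition G10 (a b c d : nat -> nat -> R) (r0 : R) : R :=
  RInt (fun theta => G a b c d 1 theta (r_s theta r0) / u theta r0) 0 (2 * PI).

Definition G20 (a b c d : nat -> nat -> R) (r0 : R) : R :=
  RInt (fun theta =>
          G a b c d 2 theta (r_s theta r0) / u theta r0
          + Derive (G a b c d 1 theta) (r_s theta r0) * u_1 a b c d theta r0
          + / 2 * Derive_n (G a b c d 0 theta) 2 (r_s theta r0) * u_1 a b c d theta r0 ^ 2)
       0 (2 * PI).

Definition second_order_averaging_applies (a b c d : nat -> nat -> R) : Prop :=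
  (forall r0, 0 < r0 -> G10 a b c d r0 = 0) /\ (exists r0, 0 < r0 /\ G20 a b c d r0 <> 0).

(* Each simple zero r0 of G20 in (0, oo) stands for one limit cycle bifurcating
   from the periodic orbit of the center through (r0, 0). *)
Definition bifurcating_limit_cycle (a b c d : nat -> nat -> R) (r0 : R) : Prop :=
  0 < r0 /\ G20 a b c d r0 = 0 /\ exists l, is_derive (G20 a b c d) r0 l /\ l <> 0.

Lemma thetadot_unperturbed (a b c d : nat -> nat -> R) (theta r : R) : 0 < r -> thetadot a b c d 0 theta r = r ^ 2.
Proof.
intros Hr; unfold thetadot, Xeps, Yeps, X0, Y0.
pose proof (sin2_cos2 theta) as H; unfold Rsqr in H.
transitivity (r ^ 2 * (sin theta * sin theta + cos theta * cos theta) ^ 2).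
- field; lra.
- rewrite H; ring.
Qed.

Lemma G_0_eq (a b c d : nat -> nat -> R) (theta r : R) :
  0 < r -> G a b c d 0 theta r = - 2 * r * cos theta * sin theta.
Proof.
intros Hr; unfold G; simpl Derive_n; rewrite thetadot_unperturbed by assumption.
unfold rdot, Xeps, Yeps, X0, Y0.
pose proof (sin2_cos2 theta) as H; unfold Rsqr in H.
transitivity (- 2 * r * cos theta * sin theta
              * (sin theta * sin theta + cos theta * cos theta)).
- simpl fact; simpl INR; field; lra.
- rewrite H; ring.
Qed.

Lemma r_s_0 (r0 : R) : r_s 0 r0 = r0.
Proof.
unfold r_s; rewrite sin_0.
replace (- 0 ^ 2) with 0 by ring; rewrite exp_0; ring.
Qed.

Lemma is_derive_r_s (a b c d : nat -> nat -> R) (theta r0 : R) : 0 < r0 ->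
  is_derive (fun t => r_s t r0) theta (G a b c d 0 theta (r_s theta r0)).
Proof.
intros Hr; rewrite G_0_eq.
- unfold r_s; auto_derive; [exact I | simpl; ring].
- apply Rmult_lt_0_compat; [assumption | apply exp_pos].
Qed.

Lemma u_0 (r0 : R) : u 0 r0 = 1.
Proof.
unfold u; rewrite sin_0; replace (- 0 ^ 2) with 0 by ring; apply exp_0.
Qed.

Lemma is_derive_u (a b c d : nat -> nat -> R) (theta r0 : R) : 0 < r0 ->
  is_derive (fun t => u t r0) theta
    (Derive (G a b c d 0 theta) (r_s theta r0) * u theta r0).
Proof.
intros Hr.
assert (Hp : 0 < r_s theta r0)
  by (apply Rmult_lt_0_compat; [assumption | apply exp_pos]).
replace (Derive (G a b c d 0 theta) (r_s theta r0))
  with (- 2 * cos theta * sin theta).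
- unfold u; auto_derive; [exact I | simpl; ring].
- symmetry; apply is_derive_unique.
  apply is_derive_ext_loc with (fun r => - 2 * r * cos theta * sin theta).
  + exists (mkposreal _ Hp); intros r Hb; symmetry; apply G_0_eq.
    change (Rabs (r - r_s theta r0) < r_s theta r0) in Hb.
    apply Rabs_def2 in Hb; lra.
  + auto_derive; [exact I | simpl; ring].
Qed.

Definition at_most (n : nat) (P : R -> Prop) : Prop :=
  forall l : list R, NoDup l -> (forall r, In r l -> P r) -> (length l <= n)%nat.

Definition exactly (n : nat) (P : R -> Prop) : Prop :=
  exists l : list R, NoDup l /\ length l = n /\ (forall r, In r l <-> P r).

(* Main.v *)
Require Import Defs.
From Stdlib Require Import Reals Ranalysis5 Lra Lia List Factorial Nsatz.
From Coquelicot Require Import Coquelicot.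
Open Scope R_scope.

(** The unperturbed orbits are r = rho exp (- sin^2 theta), so rho = r exp (sin^2 theta) is a
first integral, and along an orbit theta' = r^2 > 0: time is an increasing function of theta, and
inverting it turns these curves into periodic solutions ([unperturbed_periodic_orbit]).

Split the perturbation into its homogeneous parts of degree k <= 3.  In the coordinate rho the
equation has no zeroth-order part, its first-order part is the sum over k of
rho^(k-2) E_k(theta), with E_k = [forcing A C k], and everything is a Laurent polynomial in rho
whose coefficients are functions of theta.  Hence G10 and G20 are Laurent polynomials in rho:
with M_k the primitive of E_k vanishing at 0 and Q_j = [twist A C j] the perturbation of the
angular speed,
  rho^5 G20 = sum_(j,k) rho^(j+k) int E_k ((k-2) M_j - Q_j) + sum_k rho^(k+3) int E'_k,
where E'_k is built from the second-order coefficients ([G20_expansion]).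

A form of degree k takes the sign (-1)^k under the half turn theta -> theta + pi.  When G10 = 0
this kills every odd power of rho in rho^5 G20 ([interaction_odd]), so rho^5 G20 is a polynomial
of degree at most 3 in rho^2 ([G20_cubic]).  It is not zero by assumption, so it has at most three
positive zeros.

Conversely, every cubic in rho^2 occurs ([realize_cubic]).  Take the first-order perturbation
(alpha, 1) + lambda (x^2 - y^2, 2 x y) and the second-order one
(delta + eta (x^2 + y^2)) (x, y).  The four coefficients are then alpha, - lambda, delta and
eta times four positive constants.  The cubics 1, w - 1, (w - 1)(w - 4) and
(w - 1)(w - 4)(w - 9) in w = rho^2 give the examples. *)

(** * Continuous functions and their integrals *)
Lemma continuous_derivable (f : R -> R) t : ex_derive f t -> continuous f t.
Proof. exact (ex_derive_continuous f t). Qed.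

Lemma continuous_mult_l (f : R -> R) l t :
  continuous f t -> continuous (fun t => l * f t) t.
Proof. apply (continuous_scal_r (V := R_NormedModule) l). Qed.

Lemma continuous_sum (f : nat -> R -> R) n t :
  (forall k, continuous (f k) t) -> continuous (fun t => sum_f_R0 (fun k => f k t) n) t.
Proof.
intros Hf; induction n as [| n IH]; simpl; [apply Hf |].
apply (continuous_plus (V := R_NormedModule) _ (f (S n))); [exact IH | apply Hf].
Qed.

Lemma ex_RInt_everywhere (f : R -> R) (a b : R) :
  (forall x, continuous f x) -> ex_RInt f a b.
Proof. intros Hf; apply (@ex_RInt_continuous R_CompleteNormedModule); intros; apply Hf. Qed.

Lemma RInt_eq (f g : R -> R) a b : (forall t, f t = g t) -> RInt f a b = RInt g a b.
Proof. intros H; apply (@RInt_ext R_CompleteNormedModule); intros; apply H. Qed.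

Lemma RInt_mult_l (f : R -> R) l a b :
  (forall t, continuous f t) -> RInt (fun t => l * f t) a b = l * RInt f a b.
Proof.
intros Hf; apply (@RInt_scal R_CompleteNormedModule f a b l).
now apply ex_RInt_everywhere.
Qed.

Lemma RInt_add (f g : R -> R) a b :
  (forall t, continuous f t) -> (forall t, continuous g t) ->
  RInt (fun t => f t + g t) a b = RInt f a b + RInt g a b.
Proof.
intros Hf Hg; apply (@RInt_plus R_CompleteNormedModule f g);
  now apply ex_RInt_everywhere.
Qed.

Lemma RInt_sum (f : nat -> R -> R) n a b :
  (forall k t, continuous (f k) t) ->
  RInt (fun t => sum_f_R0 (fun k => f k t) n) a b = sum_f_R0 (fun k => RInt (f k) a b) n.
Proof.
intros Hf; induction n as [| n IH]; simpl; [reflexivity |].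
rewrite <- IH; apply (@RInt_plus R_CompleteNormedModule _ (f (S n)));
  apply ex_RInt_everywhere; intros t; [apply continuous_sum; intros; apply Hf | apply Hf].
Qed.

Lemma RInt_zero (f : R -> R) a b : (forall t, f t = 0) -> RInt f a b = 0.
Proof.
intros H; rewrite (RInt_eq f (fun _ => 0)) by exact H.
rewrite (@RInt_const R_CompleteNormedModule); unfold scal; simpl; unfold mult; simpl; ring.
Qed.

Lemma is_derive_primitive (f : R -> R) (a x : R) :
  (forall z, continuous f z) -> is_derive (fun t => RInt f a t) x (f x).
Proof.
intros Hf; apply (is_derive_RInt f (RInt f a) a x); [| apply Hf].
apply filter_forall; intros t; apply (@RInt_correct R_CompleteNormedModule).
now apply ex_RInt_everywhere.
Qed.

Lemma RInt_derivative (F f : R -> R) a b :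
  (forall t, is_derive F t (f t)) -> (forall t, continuous f t) ->
  RInt f a b = F b - F a.
Proof.
intros dF cf; apply is_RInt_unique, (is_RInt_derive F f); intros; [apply dF | apply cf].
Qed.

Lemma RInt_shift (f : R -> R) (T a b : R) :
  (forall x, continuous f x) -> RInt (fun x => f (x + T)) a b = RInt f (a + T) (b + T).
Proof.
intros Hf.
pose proof (RInt_comp_lin f 1 T a b) as H.
rewrite !Rmult_1_l in H; rewrite <- H by now apply ex_RInt_everywhere.
apply RInt_ext; intros x _; rewrite !Rmult_1_l; unfold scal; simpl; unfold mult; simpl; ring.
Qed.

(** Integrands are compared modulo exact differentials; with F periodic and [a, b] a full turn this
evaluates integrals that have no elementary primitive in terms of simpler ones. *)
Lemma RInt_mod_exact (f g F : R -> R) a b :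
  (forall t, continuous f t) -> (forall t, continuous g t) ->
  (forall t, is_derive F t (f t - g t)) -> F a = F b -> RInt f a b = RInt g a b.
Proof.
intros cf cg dF E.
rewrite (RInt_eq f (fun t => g t + (f t - g t))) by (intros; ring).
assert (cd : forall t, continuous (fun t => f t - g t) t).
{ intros t; now apply (continuous_minus (V := R_NormedModule)). }
rewrite RInt_add by assumption.
rewrite (RInt_derivative F (fun t => f t - g t)) by assumption.
rewrite E, Rminus_diag; apply Rplus_0_r.
Qed.

Lemma exp_INR_mult (k x : R) (n : nat) : k = INR n -> exp (k * x) = exp x ^ n.
Proof.
intros ->; rewrite <- Rpower_pow by apply exp_pos.
unfold Rpower; now rewrite ln_exp.
Qed.

(** * The unperturbed center *)

(** The autonomous equation g' = 1 / f(g) is solved for all times by inverting a primitive F of f: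
the lower bound m makes F onto, and its inverse Lipschitz, hence continuous, which is what the
inverse-function rule for derivatives asks for. *)
Lemma inverse_function (F f : R -> R) (m : R) :
  0 < m -> (forall x, is_derive F x (f x)) -> (forall x, m <= f x) ->
  exists g : R -> R,
    (forall t, F (g t) = t) /\ (forall x, g (F x) = x) /\
    (forall t, is_derive g t (/ f (g t))).
Proof.
intros Hm dF Hf.
assert (growth : forall x y, x <= y -> m * (y - x) <= F y - F x).
{ intros x y Hxy; destruct (MVT_gen F x y f) as [z [_ Hz]].
  - intros; apply dF.
  - intros z _; apply continuity_pt_filterlim; apply (ex_derive_continuous F z).
    now exists (f z).
  - rewrite Hz; apply Rmult_le_compat_r; [lra | apply Hf]. }
assert (cF : continuity F).
{ intros z; apply continuity_pt_filterlim; apply (ex_derive_continuous F z).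
  now exists (f z). }
assert (inv : forall t, {x | F x = t}).
{ intros t.
  set (w := Rabs (t - F 0) / m).
  assert (Hw : 0 <= w) by (apply Rdiv_le_0_compat; [apply Rabs_pos | assumption]).
  assert (mw : m * w = Rabs (t - F 0)) by (unfold w; field; lra).
  destruct (IVT_gen F (- w) w t cF) as [x [_ Hx]]; [ | now exists x].
  pose proof (growth 0 w Hw); pose proof (growth (- w) 0 ltac:(lra)).
  pose proof (Rle_abs (t - F 0)); pose proof (Rle_abs (- (t - F 0))) as H2.
  rewrite Rabs_Ropp in H2.
  rewrite Rmin_left, Rmax_right by nra; nra. }
set (g := fun t => proj1_sig (inv t)).
assert (Fg : forall t, F (g t) = t) by (intros t; exact (proj2_sig (inv t))).
assert (inj : forall x y, F x = F y -> x = y).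
{ intros x y E; destruct (Rle_or_lt x y) as [L | L].
  - pose proof (growth x y L); nra.
  - pose proof (growth y x ltac:(lra)); nra. }
assert (ginc : forall s t, s <= t -> g s <= g t <= g s + (t - s) / m).
{ intros s t Hst.
  assert (L : g s <= g t).
  { destruct (Rle_or_lt (g s) (g t)) as [L | L]; [exact L |].
    pose proof (growth _ _ (Rlt_le _ _ L)) as H; rewrite !Fg in H; nra. }
  split; [exact L |].
  pose proof (growth _ _ L) as H; rewrite !Fg in H.
  apply Rmult_le_reg_l with m; [assumption |].
  replace (m * (g s + (t - s) / m)) with (m * g s + (t - s)) by (field; lra); lra. }
exists g; split; [exact Fg | split; [now intros x; apply inj |]].
intros t.
assert (cg : continuity_pt g t).
{ intros eps Heps; exists (m * eps); split; [nra |].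
  intros s [_ Hs]; simpl in Hs |- *; unfold R_dist in *.
  apply Rabs_def2 in Hs.
  assert (K : forall d, d < m * eps -> d / m < eps).
  { intros d Hd; apply Rmult_lt_reg_l with m; [assumption |].
    replace (m * (d / m)) with d by (field; lra); lra. }
  destruct (Rle_or_lt s t) as [L | L].
  - pose proof (ginc s t L); pose proof (K (t - s) ltac:(lra)).
    apply Rabs_def1; lra.
  - pose proof (ginc t s ltac:(lra)); pose proof (K (s - t) ltac:(lra)).
    apply Rabs_def1; lra. }
assert (pF : forall x, derivable_pt F x)
  by (intros x; exists (f x); now apply is_derive_Reals).
assert (vF : forall x (p : derivable_pt F x), derive_pt F x p = f x).
{ intros x p; apply derive_pt_eq_0; now apply is_derive_Reals. }
apply is_derive_Reals.
assert (Hg : g (t - 1) <= g t <= g (t + 1)).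
{ split; [apply (ginc (t - 1) t) | apply (ginc t (t + 1))]; lra. }
pose proof (derivable_pt_lim_recip_interv F g (t - 1) (t + 1) t
  (fun x _ => pF x) cg ltac:(lra) ltac:(lra) Hg) as D.
cbv beta in D; rewrite vF in D.
replace (/ f (g t)) with (1 / f (g t)) by (unfold Rdiv; ring).
apply D.
- intros x _; apply Fg.
- specialize (Hf (g t)); lra.
Qed.

Lemma polar_coordinates (x y : R) :
  exists rho theta, 0 <= rho /\ x = rho * cos theta /\ y = rho * sin theta.
Proof.
set (rho := sqrt (x ^ 2 + y ^ 2)).
assert (Hrho : rho * rho = x ^ 2 + y ^ 2) by (apply sqrt_sqrt; nra).
assert (P : 0 <= rho) by apply sqrt_pos.
destruct (Rle_lt_or_eq_dec 0 rho P) as [Hp | H0].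
- set (z := x / rho).
  assert (xz : x = rho * z) by (unfold z; field; lra).
  assert (Hz : -1 <= z <= 1).
  { assert (E : rho * rho * (1 - z * z) = y * y) by (rewrite xz in Hrho; nra).
    assert (0 < rho * rho) by (now apply Rmult_lt_0_compat).
    assert (0 <= 1 - z * z).
    { destruct (Rle_or_lt 0 (1 - z * z)) as [L | L]; [exact L |].
      pose proof (Rmult_lt_gt_compat_neg_l (1 - z * z) 0 (rho * rho) L ltac:(lra)); nra. }
    split; nra. }
  assert (S : rho * sqrt (1 - Rsqr z) = Rabs y).
  { rewrite <- (Rabs_right rho) at 1 by lra.
    rewrite <- sqrt_Rsqr_abs, <- sqrt_mult by (unfold Rsqr; nra).
    rewrite <- sqrt_Rsqr_abs; f_equal; unfold Rsqr; rewrite xz in Hrho; nra. }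
  destruct (Rle_or_lt 0 y) as [Hy | Hy].
  + exists rho, (acos z); rewrite cos_acos, sin_acos, S, Rabs_right by lra.
    now repeat split.
  + exists rho, (- acos z).
    rewrite cos_neg, sin_neg, cos_acos, sin_acos by lra.
    rewrite Ropp_mult_distr_r_reverse, S, Rabs_left by lra.
    repeat split; [lra | assumption | lra].
- exists 0, 0; rewrite <- H0 in Hrho; repeat split; nra.
Qed.

Lemma sin_shift_2PI t : sin (t + 2 * PI) = sin t.
Proof. rewrite sin_plus, sin_2PI, cos_2PI; ring. Qed.

Lemma cos_shift_2PI t : cos (t + 2 * PI) = cos t.
Proof. rewrite cos_plus, sin_2PI, cos_2PI; ring. Qed.

(** The angle theta(t) is the inverse of the time function, the integral of 1 / r^2 from theta0 to
theta; the period is its increment over a full turn. *)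
Lemma unperturbed_periodic_orbit (x0 y0 : R) :
  (x0, y0) <> (0, 0) -> on_periodic_orbit X0 Y0 x0 y0.
Proof.
intros Hne.
destruct (polar_coordinates x0 y0) as (R0 & th0 & HR & Hx0 & Hy0).
assert (HR0 : 0 < R0).
{ destruct HR as [HR | HR]; [exact HR |].
  exfalso; apply Hne; rewrite Hx0, Hy0, <- HR, !Rmult_0_l; reflexivity. }
set (rho := R0 * exp (sin th0 ^ 2)).
assert (Hrho : 0 < rho) by (apply Rmult_lt_0_compat; [lra | apply exp_pos]).
(* theta' = r^2 = 1 / h(theta), so h is the density of time with respect to theta. *)
set (h := fun th => / rho ^ 2 * exp (2 * sin th ^ 2)).
assert (cont : forall th, continuous h th).
{ intros th; apply (ex_derive_continuous h th); unfold h; auto_derive; exact I. }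
set (T := RInt h th0 (th0 + 2 * PI)).
assert (Hi : 0 < / rho ^ 2) by (apply Rinv_0_lt_compat, pow_lt; lra).
destruct (inverse_function (fun th => RInt h th0 th) h (/ rho ^ 2)) as (g & Fg & gF & dg).
- exact Hi.
- intros th; now apply is_derive_primitive.
- intros th; unfold h; rewrite <- Rmult_1_r at 1.
  apply Rmult_le_compat_l; [lra |].
  rewrite <- exp_0; destruct (pow2_ge_0 (sin th)) as [L | L];
    [left; apply exp_increasing; lra | right; f_equal; lra].
- cbv beta in *.
  assert (HT : 0 < T).
  { apply RInt_gt_0; [pose proof PI_RGT_0; lra | | intros; apply cont].
    intros th _; apply Rmult_lt_0_compat; [exact Hi | apply exp_pos]. }
  assert (gT : forall t, g (t + T) = g t + 2 * PI).
  { intros t; rewrite <- (gF (g t + 2 * PI)); f_equal.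
    rewrite <- (@RInt_Chasles R_CompleteNormedModule h th0 (th0 + 2 * PI))
      by now apply ex_RInt_everywhere.
    fold T; rewrite <- (RInt_shift h (2 * PI) th0 (g t)) by assumption.
    rewrite (RInt_ext _ h).
    - rewrite Fg; unfold plus; simpl; ring.
    - intros th _; unfold h; now rewrite sin_shift_2PI. }
  assert (g0 : g 0 = th0).
  { rewrite <- (gF th0); f_equal; symmetry; apply (@RInt_point R_CompleteNormedModule). }
  assert (dg' : forall t, is_derive g t (rho ^ 2 * exp (- (sin (g t)) ^ 2) ^ 2)).
  { intros t; replace (rho ^ 2 * exp (- (sin (g t)) ^ 2) ^ 2) with (/ h (g t)); [apply dg |].
    unfold h; replace (2 * sin (g t) ^ 2) with (sin (g t) ^ 2 + sin (g t) ^ 2) by ring.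
    rewrite exp_plus, exp_Ropp; field; split; [apply Rgt_not_eq, exp_pos | lra]. }
  pose proof (exp_plus (sin th0 ^ 2) (- sin th0 ^ 2)) as Hexp.
  rewrite Rplus_opp_r, exp_0 in Hexp.
  assert (r0 : rho * exp (- sin th0 ^ 2) = R0)
    by (unfold rho; rewrite Rmult_assoc, <- Hexp; ring).
  exists T, (fun t => rho * exp (- sin (g t) ^ 2) * cos (g t)),
    (fun t => rho * exp (- sin (g t) ^ 2) * sin (g t)).
  split; [exact HT |].
  rewrite g0, r0; split; [now symmetry | split; [now symmetry |]].
  split; [ | split; [ | split]].
  + intros t.
    evar_last;
      [eapply (is_derive_comp (fun th => rho * exp (- sin th ^ 2) * cos th) g);
       [auto_derive; [exact I | reflexivity] | apply dg'] |].
    unfold scal; simpl; unfold mult; simpl; unfold X0; rewrite ?Rmult_1_r.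
    pose proof (sin2_cos2 (g t)) as H; unfold Rsqr in H.
    set (s := sin (g t)) in *; set (c := cos (g t)) in *; set (e := exp (- (s * s))).
    transitivity (- (rho * e) ^ 3 * s * (2 * (c * c) + 1)); [ring | rewrite <- H; ring].
  + intros t.
    evar_last;
      [eapply (is_derive_comp (fun th => rho * exp (- sin th ^ 2) * sin th) g);
       [auto_derive; [exact I | reflexivity] | apply dg'] |].
    unfold scal; simpl; unfold mult; simpl; unfold Y0; rewrite ?Rmult_1_r.
    pose proof (sin2_cos2 (g t)) as H; unfold Rsqr in H.
    set (s := sin (g t)) in *; set (c := cos (g t)) in *; set (e := exp (- (s * s))).
    transitivity ((rho * e) ^ 3 * c * (1 - 2 * (s * s))); [ring | rewrite <- H; ring].
  + intros t; now rewrite gT, sin_shift_2PI, cos_shift_2PI.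
  (* After half a turn the solution is at the opposite point. *)
  + exists (RInt h th0 (th0 + PI)); rewrite gF, neg_cos, neg_sin.
    replace (- sin th0) with (-1 * sin th0) by ring.
    replace (- (-1 * sin th0) ^ 2) with (- sin th0 ^ 2) by ring.
    rewrite r0.
    destruct (Req_dec x0 0) as [E | E]; [right | left; lra].
    intros E2; apply Hne; f_equal; lra.
Qed.

Lemma global_center : global_center_at_origin X0 Y0.
Proof.
assert (H : forall x y, (x, y) <> (0, 0) -> on_periodic_orbit X0 Y0 x y)
  by exact unperturbed_periodic_orbit.
split; [ | exact H].
split; [unfold X0; ring | split; [unfold Y0; ring |]].
exists 1; split; [lra |].
intros x y [Hp _]; apply H; intros E; injection E as -> ->; lra.
Qed.

(** * The perturbed equation in polar coordinates *)

Definition form (p : nat -> nat -> R) (k : nat) (t : R) : R :=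
  sum_f_R0 (fun i => p i (k - i)%nat * cos t ^ i * sin t ^ (k - i)) k.

Definition radial (A C : nat -> nat -> R) (k : nat) (t : R) : R :=
  cos t * form A k t + sin t * form C k t.

Definition angular (A C : nat -> nat -> R) (k : nat) (t : R) : R :=
  cos t * form C k t - sin t * form A k t.

(** The first-order change of dr/dtheta caused by the part of degree k is r^(k-2) times this: the
radial part, corrected because the unperturbed slope - 2 r cos theta sin theta is divided by a
perturbed angular speed. *)
Definition drift (A C : nat -> nat -> R) (k : nat) (t : R) : R :=
  radial A C k t + 2 * cos t * sin t * angular A C k t.

Definition radial_series (f : nat -> R -> R) (t r : R) : R :=
  sum_f_R0 (fun k => r ^ k * f k t) 3.

Lemma cubic_polar p t r : cubic p (r * cos t) (r * sin t) = radial_series (form p) t r.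
Proof. unfold cubic, radial_series, form; simpl; ring. Qed.

Lemma rdot_polar a b c d eps t r :
  rdot a b c d eps t r =
  - 2 * r ^ 3 * cos t * sin t + eps * radial_series (radial a c) t r
  + eps ^ 2 * radial_series (radial b d) t r.
Proof.
unfold rdot, Xeps, Yeps; rewrite !cubic_polar.
pose proof (sin2_cos2 t) as H; unfold Rsqr in H.
assert (H0 : cos t * X0 (r * cos t) (r * sin t) + sin t * Y0 (r * cos t) (r * sin t)
  = - 2 * r ^ 3 * cos t * sin t).
{ unfold X0, Y0.
  transitivity (- 2 * r ^ 3 * cos t * sin t * (sin t * sin t + cos t * cos t));
    [ring | rewrite H; ring]. }
rewrite <- H0; unfold radial_series, radial; simpl; ring.
Qed.

Lemma thetadot_polar a b c d eps t r : 0 < r ->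
  thetadot a b c d eps t r =
  r ^ 2 + eps * (radial_series (angular a c) t r / r) + eps ^ 2 * (radial_series (angular b d) t r / r).
Proof.
intros Hr.
rewrite <- (thetadot_unperturbed a b c d t r Hr); unfold thetadot, Xeps, Yeps.
rewrite !cubic_polar; unfold radial_series, angular; simpl; field; lra.
Qed.

(** The second derivative at 0 needs the formula for the first one on a neighbourhood of 0, where the
denominator stays nonzero. *)
Lemma quotient_taylor (n0 n1 n2 d0 d1 d2 : R) (f : R -> R) : d0 <> 0 ->
  (forall e, f e = (n0 + e * n1 + e ^ 2 * n2) / (d0 + e * d1 + e ^ 2 * d2)) ->
  Derive_n f 1 0 = n1 / d0 - n0 * d1 / d0 ^ 2 /\
  Derive_n f 2 0 / 2 =
    n2 / d0 - n1 * d1 / d0 ^ 2 - n0 * d2 / d0 ^ 2 + n0 * d1 ^ 2 / d0 ^ 3.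
Proof.
intros Hd0 Hf.
set (D := fun e => d0 + e * d1 + e ^ 2 * d2).
set (N' := fun e => n1 + 2 * e * n2); set (D' := fun e => d1 + 2 * e * d2).
set (f' := fun e => (N' e * D e - (n0 + e * n1 + e ^ 2 * n2) * D' e) / D e ^ 2).
assert (HD : locally 0 (fun e => D e <> 0)).
{ assert (cD : continuous D 0).
  { apply (ex_derive_continuous D 0); unfold D; auto_derive; exact I. }
  apply (cD (fun z => z <> 0)), open_neq; unfold D; lra. }
assert (Df : locally 0 (fun e => Derive f e = f' e)).
{ generalize HD; apply filter_imp; intros e He; apply is_derive_unique.
  apply is_derive_ext with
    (fun e => (n0 + e * n1 + e ^ 2 * n2) / (d0 + e * d1 + e ^ 2 * d2)).
  { intros t; symmetry; apply Hf. }
  unfold f', N', D' in *; unfold D in *; auto_derive; [exact He |].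
  field; exact He. }
split.
- change (Derive f 0 = n1 / d0 - n0 * d1 / d0 ^ 2).
  rewrite (locally_singleton _ _ Df); unfold f', N', D', D; field; lra.
- change (Derive (Derive f) 0 / 2 =
    n2 / d0 - n1 * d1 / d0 ^ 2 - n0 * d2 / d0 ^ 2 + n0 * d1 ^ 2 / d0 ^ 3).
  rewrite (Derive_ext_loc _ f' 0 Df).
  rewrite (is_derive_unique f' 0
    (2 * (n2 / d0 - n1 * d1 / d0 ^ 2 - n0 * d2 / d0 ^ 2 + n0 * d1 ^ 2 / d0 ^ 3))).
  + simpl; field; lra.
  + unfold f', N', D', D; auto_derive.
    * simpl. intros H; apply Hd0. nra.
    * field; lra.
Qed.

Lemma G_1_eq a b c d t r : 0 < r -> G a b c d 1 t r = radial_series (drift a c) t r / r ^ 2.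
Proof.
intros Hr; unfold G; change (INR (fact 1)) with 1.
destruct (quotient_taylor _ _ _ _ _ _
  (fun eps => rdot a b c d eps t r / thetadot a b c d eps t r)
  (pow_nonzero r 2 ltac:(lra))
  (fun e => f_equal2 Rdiv (rdot_polar a b c d e t r) (thetadot_polar a b c d e t r Hr)))
  as [-> _].
unfold radial_series, drift; simpl; field; lra.
Qed.

Lemma G_2_eq a b c d t r : 0 < r ->
  G a b c d 2 t r = radial_series (drift b d) t r / r ^ 2
                    - radial_series (angular a c) t r * radial_series (drift a c) t r / r ^ 5.
Proof.
intros Hr; unfold G; change (INR (fact 2)) with 2.
destruct (quotient_taylor _ _ _ _ _ _
  (fun eps => rdot a b c d eps t r / thetadot a b c d eps t r)
  (pow_nonzero r 2 ltac:(lra))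
  (fun e => f_equal2 Rdiv (rdot_polar a b c d e t r) (thetadot_polar a b c d e t r Hr)))
  as [_ ->].
unfold radial_series, drift; simpl; field; lra.
Qed.

Lemma locally_pos (r : R) : 0 < r -> locally r (fun x => 0 < x).
Proof. intros Hr; now apply (open_gt 0). Qed.

Lemma Derive_G_1 a b c d t r : 0 < r ->
  Derive (G a b c d 1 t) r =
  sum_f_R0 (fun k => (INR k - 2) * r ^ k * drift a c k t) 3 / r ^ 3.
Proof.
intros Hr; apply is_derive_unique.
apply is_derive_ext_loc with (fun r => radial_series (drift a c) t r / r ^ 2).
- generalize (locally_pos r Hr); apply filter_imp; intros x Hx; symmetry.
  now apply G_1_eq.
- unfold radial_series; simpl sum_f_R0; simpl INR; auto_derive; [nra | field; lra].
Qed.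

Lemma Derive_2_G_0 a b c d t r : 0 < r -> Derive_n (G a b c d 0 t) 2 r = 0.
Proof.
intros Hr.
rewrite (Derive_n_ext_loc _ (fun r => (- 2 * cos t * sin t) * r) 2 r).
- simpl; rewrite (Derive_ext _ (fun _ => - 2 * cos t * sin t)).
  + apply Derive_const.
  + intros x; apply is_derive_unique; auto_derive; [exact I | ring].
- generalize (locally_pos r Hr); apply filter_imp; intros x Hx.
  rewrite G_0_eq by exact Hx; ring.
Qed.

(** * Expansion of the averaged functions in powers of the initial radius *)

(** The drift and the angular part, rescaled to the coordinate rho = r exp (sin^2 theta): the
exponent 3 - k collects r^(k-2) on the orbit and the division by the variational solution u. *)
Definition forcing (A C : nat -> nat -> R) (k : nat) (t : R) : R :=
  exp ((3 - INR k) * sin t ^ 2) * drift A C k t.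

Definition twist (A C : nat -> nat -> R) (k : nat) (t : R) : R :=
  exp ((3 - INR k) * sin t ^ 2) * angular A C k t.

Definition forcing_primitive (A C : nat -> nat -> R) (k : nat) (t : R) : R :=
  RInt (forcing A C k) 0 t.

(** The coefficient of rho^(j+k-5) in the integrand of G20: the factor k - 2 comes from the
r-derivative of r^(k-2), multiplied by u_1, and the twist from the second-order term of the
quotient. *)
Definition interaction (A C : nat -> nat -> R) (j k : nat) (t : R) : R :=
  forcing A C k t * ((INR k - 2) * forcing_primitive A C j t - twist A C j t).

Lemma ex_derive_form p k t : ex_derive (form p k) t.
Proof.
assert (monomial : forall x i j, ex_derive (fun t => x * cos t ^ i * sin t ^ j) t)
  by (intros; auto_derive; exact I).
assert (sums : forall n, ex_derive
  (fun t => sum_f_R0 (fun i => p i (k - i)%nat * cos t ^ i * sin t ^ (k - i)) n) t).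
{ intros n; induction n as [| n IH]; [apply monomial |].
  apply (ex_derive_plus (V := R_NormedModule) _ _ t IH), monomial. }
apply sums.
Qed.

Lemma continuous_forcing A C k t : continuous (forcing A C k) t.
Proof.
apply (ex_derive_continuous (forcing A C k) t).
unfold forcing, drift, radial, angular.
auto_derive; repeat split; apply ex_derive_form.
Qed.

Lemma continuous_twist A C k t : continuous (twist A C k) t.
Proof.
apply (ex_derive_continuous (twist A C k) t); unfold twist, angular.
auto_derive; repeat split; apply ex_derive_form.
Qed.

Lemma is_derive_primitive_forcing A C k t :
  is_derive (forcing_primitive A C k) t (forcing A C k t).
Proof. apply is_derive_primitive, continuous_forcing. Qed.

Lemma continuous_primitive A C k t : continuous (forcing_primitive A C k) t.
Proof.
apply (ex_derive_continuous (forcing_primitive A C k) t); eexists.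
apply is_derive_primitive_forcing.
Qed.

Lemma continuous_interaction A C j k t : continuous (interaction A C j k) t.
Proof.
apply (continuous_mult (K := R_AbsRing)); [apply continuous_forcing |].
apply (continuous_minus (V := R_NormedModule)); [| apply continuous_twist].
apply (continuous_scal_r (V := R_NormedModule) (INR k - 2)), continuous_primitive.
Qed.

Lemma continuous_series (f : nat -> R -> R) rho t :
  (forall k, continuous (f k) t) -> continuous (fun t => radial_series f t rho) t.
Proof. intros Hf; apply continuous_sum; intros k; now apply continuous_mult_l. Qed.

Lemma weight_r_s k t : (k <= 3)%nat ->
  exp ((3 - INR k) * sin t ^ 2) = exp (- sin t ^ 2) ^ k / exp (- sin t ^ 2) ^ 3.
Proof.
intros Hk.
rewrite <- !exp_INR_mult with (k := INR _) by reflexivity.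
unfold Rdiv; rewrite <- exp_Ropp, <- exp_plus; f_equal; simpl; ring.
Qed.

(** Only u enters, which has the same values for all second arguments; 0 is a placeholder. *)
Lemma forcing_weight A C k t : (k <= 3)%nat ->
  forcing A C k t = u t 0 ^ k / u t 0 ^ 3 * drift A C k t.
Proof. intros Hk; unfold forcing, u; now rewrite weight_r_s. Qed.

Lemma twist_weight A C k t : (k <= 3)%nat ->
  twist A C k t = u t 0 ^ k / u t 0 ^ 3 * angular A C k t.
Proof. intros Hk; unfold twist, u; now rewrite weight_r_s. Qed.

Lemma G_1_orbit a b c d t rho : 0 < rho ->
  G a b c d 1 t (r_s t rho) / u t rho = / rho ^ 2 * radial_series (forcing a c) t rho.
Proof.
intros Hr.
assert (Hv : 0 < u t 0) by apply exp_pos.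
change (r_s t rho) with (rho * u t 0); change (u t rho) with (u t 0).
rewrite G_1_eq by now apply Rmult_lt_0_compat.
unfold radial_series; simpl sum_f_R0; rewrite !forcing_weight by lia.
field; lra.
Qed.

Lemma RInt_series (f : nat -> R -> R) l rho a b :
  (forall k t, continuous (f k) t) ->
  RInt (fun t => l * radial_series f t rho) a b =
  l * sum_f_R0 (fun k => rho ^ k * RInt (f k) a b) 3.
Proof.
intros Hf; unfold radial_series.
assert (Hf' : forall k t, continuous (fun t => rho ^ k * f k t) t)
  by (intros; now apply continuous_mult_l).
rewrite RInt_mult_l by (intros; now apply continuous_sum).
f_equal; rewrite (RInt_sum (fun k t => rho ^ k * f k t)) by exact Hf'.
apply sum_eq; intros k _; now apply RInt_mult_l.
Qed.

Lemma u_1_eq a b c d t rho : 0 < rho ->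
  u_1 a b c d t rho = / rho ^ 2 * radial_series (forcing_primitive a c) t rho.
Proof.
intros Hr; unfold u_1.
rewrite (RInt_ext _ (fun t => / rho ^ 2 * radial_series (forcing a c) t rho))
  by (intros; now apply G_1_orbit).
apply RInt_series, continuous_forcing.
Qed.

Lemma G10_eq a b c d rho : 0 < rho ->
  G10 a b c d rho =
  / rho ^ 2 * sum_f_R0 (fun k => rho ^ k * forcing_primitive a c k (2 * PI)) 3.
Proof. exact (u_1_eq a b c d (2 * PI) rho). Qed.

Lemma G20_integrand a b c d t rho : 0 < rho ->
  G a b c d 2 t (r_s t rho) / u t rho
  + Derive (G a b c d 1 t) (r_s t rho) * u_1 a b c d t rho
  + / 2 * Derive_n (G a b c d 0 t) 2 (r_s t rho) * u_1 a b c d t rho ^ 2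
  = / rho ^ 5 * sum_f_R0 (fun j => rho ^ j * radial_series (interaction a c j) t rho) 3
    + / rho ^ 2 * radial_series (forcing b d) t rho.
Proof.
intros Hr.
assert (Hv : 0 < u t 0) by apply exp_pos.
change (r_s t rho) with (rho * u t 0); change (u t rho) with (u t 0).
assert (Hrs : 0 < rho * u t 0) by now apply Rmult_lt_0_compat.
rewrite G_2_eq, Derive_G_1, Derive_2_G_0, u_1_eq by assumption.
unfold radial_series, interaction; simpl sum_f_R0; simpl INR.
rewrite !forcing_weight, !twist_weight by lia.
field; lra.
Qed.

Lemma G20_expansion a b c d rho : 0 < rho ->
  G20 a b c d rho =
  / rho ^ 5 * sum_f_R0 (fun j => rho ^ j * sum_f_R0 (fun k =>
      rho ^ k * RInt (interaction a c j k) 0 (2 * PI)) 3) 3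
  + / rho ^ 2 * sum_f_R0 (fun k => rho ^ k * forcing_primitive b d k (2 * PI)) 3.
Proof.
intros Hr; unfold G20.
set (inner := fun t => sum_f_R0 (fun j => rho ^ j * radial_series (interaction a c j) t rho) 3).
assert (cinner : forall j t, continuous (fun t => rho ^ j * radial_series (interaction a c j) t rho) t).
{ intros j t; apply continuous_mult_l, continuous_series; intros k.
  apply continuous_interaction. }
rewrite (RInt_ext _ (fun t => / rho ^ 5 * inner t + / rho ^ 2 * radial_series (forcing b d) t rho))
  by (intros; now apply G20_integrand).
rewrite RInt_add.
- f_equal.
  + rewrite RInt_mult_l by (intros t; apply continuous_sum; intros; apply cinner).
    f_equal; unfold inner.
    rewrite (RInt_sum (fun j t => rho ^ j * radial_series (interaction a c j) t rho)) by exact cinner.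
    apply sum_eq; intros j _; apply RInt_series, continuous_interaction.
  + apply RInt_series, continuous_forcing.
- intros t; apply continuous_mult_l, continuous_sum; intros; apply cinner.
- intros t; apply continuous_mult_l, continuous_series; intros; apply continuous_forcing.
Qed.

(** * Parity under the half turn *)

Definition half_turn (n : nat) (f : R -> R) : Prop :=
  forall t, f (t + PI) = (-1) ^ n * f t.

Lemma half_turn_RInt (n : nat) (f : R -> R) : Nat.Odd n ->
  half_turn n f -> (forall t, continuous f t) -> RInt f 0 (2 * PI) = 0.
Proof.
intros [m ->] Hf cf.
rewrite <- (@RInt_Chasles R_CompleteNormedModule f 0 PI (2 * PI))
  by now apply ex_RInt_everywhere.
replace (RInt f PI (2 * PI)) with (-1 * RInt f 0 PI).
- unfold plus; simpl; ring.
- rewrite <- RInt_mult_l by exact cf.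
  rewrite (RInt_ext _ (fun t => f (t + PI))).
  + rewrite RInt_shift by exact cf; f_equal; ring.
  + intros t _; rewrite Hf, Nat.add_1_r, pow_1_odd; reflexivity.
Qed.

Lemma half_turn_form p k : half_turn k (form p k).
Proof.
intros t; unfold form; rewrite scal_sum; apply sum_eq; intros i Hi.
rewrite neg_cos, neg_sin.
replace (- cos t) with (-1 * cos t) by ring; replace (- sin t) with (-1 * sin t) by ring.
rewrite !Rpow_mult_distr.
replace ((-1) ^ k) with ((-1) ^ i * (-1) ^ (k - i)); [ring |].
rewrite <- pow_add; f_equal; lia.
Qed.

Lemma half_turn_weight k t : exp (k * sin (t + PI) ^ 2) = exp (k * sin t ^ 2).
Proof. rewrite neg_sin; f_equal; ring. Qed.

Lemma half_turn_forcing A C k : half_turn (S k) (forcing A C k).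
Proof.
intros t; unfold forcing, drift, radial, angular.
rewrite half_turn_weight, neg_cos, neg_sin, !half_turn_form; simpl; ring.
Qed.

Lemma half_turn_twist A C k : half_turn (S k) (twist A C k).
Proof.
intros t; unfold twist, angular.
rewrite half_turn_weight, neg_cos, neg_sin, !half_turn_form; simpl; ring.
Qed.

Lemma half_turn_mult m n f g :
  half_turn m f -> half_turn n g -> half_turn (m + n) (fun t => f t * g t).
Proof. intros Hf Hg t; rewrite Hf, Hg, pow_add; ring. Qed.

Lemma primitive_shift A C k t :
  forcing_primitive A C k (t + PI) = forcing_primitive A C k PI + (-1) ^ S k * forcing_primitive A C k t.
Proof.
unfold forcing_primitive.
rewrite <- (@RInt_Chasles R_CompleteNormedModule _ 0 PI (t + PI))
  by (apply ex_RInt_everywhere, continuous_forcing).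
rewrite <- RInt_mult_l by apply continuous_forcing.
rewrite (RInt_ext (fun t => (-1) ^ S k * _ t) (fun t => forcing A C k (t + PI)))
  by (intros; symmetry; apply half_turn_forcing).
rewrite RInt_shift, Rplus_0_l by apply continuous_forcing; reflexivity.
Qed.

Lemma primitive_2PI A C k :
  forcing_primitive A C k (2 * PI) = (1 + (-1) ^ S k) * forcing_primitive A C k PI.
Proof. replace (2 * PI) with (PI + PI) by ring; rewrite primitive_shift; ring. Qed.

Lemma primitive_2PI_even A C k : Nat.Even k -> forcing_primitive A C k (2 * PI) = 0.
Proof.
intros [m ->]; rewrite primitive_2PI, pow_1_odd; ring.
Qed.

(** A primitive inherits the parity of its derivative up to a constant.  For even k, centring at half
the value at pi removes it; for odd k the value at pi must vanish by itself, which is the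
condition on the full turn. *)
Lemma half_turn_primitive A C k : forcing_primitive A C k (2 * PI) = 0 ->
  half_turn (S k) (fun t => forcing_primitive A C k t - forcing_primitive A C k PI / 2).
Proof.
intros H0 t; rewrite primitive_shift; rewrite primitive_2PI in H0.
destruct (Nat.Even_or_Odd k) as [[m ->] | [m ->]].
- rewrite pow_1_odd in *; field.
- replace (S (2 * m + 1)) with (2 * (S m))%nat in * by lia.
  rewrite pow_1_even in *; lra.
Qed.

(** Centring M_j as in [half_turn_primitive] changes the integrand by a multiple of E_k, whose
integral is zero; what remains is odd under the half turn. *)
Lemma interaction_odd A C j k :
  forcing_primitive A C j (2 * PI) = 0 -> forcing_primitive A C k (2 * PI) = 0 ->
  Nat.Odd (j + k) -> RInt (interaction A C j k) 0 (2 * PI) = 0.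
Proof.
intros Hj Hk Hjk.
set (mean := forcing_primitive A C j PI / 2).
set (f := fun t => forcing A C k t
  * ((INR k - 2) * (forcing_primitive A C j t - mean) - twist A C j t)).
assert (cf : forall t, continuous f t).
{ intros t; apply (continuous_mult (K := R_AbsRing)); [apply continuous_forcing |].
  apply (continuous_minus (V := R_NormedModule)); [| apply continuous_twist].
  apply continuous_mult_l, (continuous_minus (V := R_NormedModule));
    [apply continuous_primitive | apply continuous_const]. }
rewrite (RInt_eq _ (fun t => f t + (INR k - 2) * mean * forcing A C k t))
  by (intros t; unfold f, interaction; ring).
rewrite RInt_add; [ | exact cf | ].
2: { intros t; apply continuous_mult_l, continuous_forcing. }
rewrite RInt_mult_l by apply continuous_forcing.
fold (forcing_primitive A C k (2 * PI)); rewrite Hk, Rmult_0_r, Rplus_0_r.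
apply (half_turn_RInt (S k + S j)); [ | | exact cf].
- destruct Hjk as [m Hm]; exists (S m); lia.
- apply half_turn_mult; [apply half_turn_forcing |].
  intros t; rewrite half_turn_twist.
  pose proof (half_turn_primitive A C j Hj t) as Ht; cbv beta in Ht; fold mean in Ht.
  rewrite Ht; ring.
Qed.

(** The even k vanish by parity, so G10 = M_1(2 pi) / rho + M_3(2 pi) rho; the two radii 1 and 2
separate the two terms. *)
Lemma first_order_vanishes a b c d : (forall rho, 0 < rho -> G10 a b c d rho = 0) ->
  forall k, (k <= 3)%nat -> forcing_primitive a c k (2 * PI) = 0.
Proof.
intros H.
assert (E0 : forcing_primitive a c 0 (2 * PI) = 0) by (apply primitive_2PI_even; now exists 0%nat).
assert (E2 : forcing_primitive a c 2 (2 * PI) = 0) by (apply primitive_2PI_even; now exists 1%nat).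
pose proof (H 1 ltac:(lra)) as H1; pose proof (H 2 ltac:(lra)) as H2.
rewrite G10_eq in H1, H2 by lra; simpl in H1, H2; rewrite E0, E2 in H1, H2.
intros [| [| [| [| k]]]] Hk; try assumption; [lra | lra | lia].
Qed.

(** * At most three zeros *)

Definition coef0 (a b c d : nat -> nat -> R) : R := RInt (interaction a c 0 0) 0 (2 * PI).

Definition coef1 (a b c d : nat -> nat -> R) : R :=
  RInt (interaction a c 0 2) 0 (2 * PI) + RInt (interaction a c 1 1) 0 (2 * PI)
  + RInt (interaction a c 2 0) 0 (2 * PI).

Definition coef2 (a b c d : nat -> nat -> R) : R :=
  RInt (interaction a c 1 3) 0 (2 * PI) + RInt (interaction a c 2 2) 0 (2 * PI)
  + RInt (interaction a c 3 1) 0 (2 * PI) + forcing_primitive b d 1 (2 * PI).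

Definition coef3 (a b c d : nat -> nat -> R) : R :=
  RInt (interaction a c 3 3) 0 (2 * PI) + forcing_primitive b d 3 (2 * PI).

Lemma G20_cubic a b c d rho :
  (forall k, (k <= 3)%nat -> forcing_primitive a c k (2 * PI) = 0) -> 0 < rho ->
  G20 a b c d rho =
  (coef0 a b c d + coef1 a b c d * rho ^ 2 + coef2 a b c d * rho ^ 4
   + coef3 a b c d * rho ^ 6) / rho ^ 5.
Proof.
intros Hp Hr; rewrite G20_expansion by exact Hr.
assert (Z : forall j k, (j <= 3)%nat -> (k <= 3)%nat -> Nat.Odd (j + k) ->
  RInt (interaction a c j k) 0 (2 * PI) = 0).
{ intros; apply interaction_odd; auto. }
simpl sum_f_R0.
rewrite (primitive_2PI_even b d 0), (primitive_2PI_even b d 2)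
  by (apply Nat.even_spec; reflexivity).
rewrite (Z 0 1)%nat, (Z 0 3)%nat, (Z 1 0)%nat, (Z 1 2)%nat, (Z 2 1)%nat, (Z 2 3)%nat,
  (Z 3 0)%nat, (Z 3 2)%nat
  by (try lia; apply Nat.odd_spec; reflexivity).
unfold coef0, coef1, coef2, coef3; field; lra.
Qed.

(** Dividing out one root at a time, through divided differences. *)
Lemma cubic_four_roots p0 p1 p2 p3 (w x y z : R) :
  let P := fun t => p0 + p1 * t + p2 * t ^ 2 + p3 * t ^ 3 in
  w <> x -> w <> y -> w <> z -> x <> y -> x <> z -> y <> z ->
  P w = 0 -> P x = 0 -> P y = 0 -> P z = 0 -> forall t, P t = 0.
Proof.
intros P wx wy wz xy xz yz Pw Px Py Pz.
assert (divided : forall (A B C D : R) s t, s <> t ->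
  A + B * s + C * s ^ 2 + D * s ^ 3 = 0 -> A + B * t + C * t ^ 2 + D * t ^ 3 = 0 ->
  B + C * (s + t) + D * (s ^ 2 + s * t + t ^ 2) = 0).
{ intros A B C D s t Hst Hs Ht; apply Rmult_eq_reg_l with (s - t); [| lra].
  transitivity (A + B * s + C * s ^ 2 + D * s ^ 3 - (A + B * t + C * t ^ 2 + D * t ^ 3));
    [ring | lra]. }
unfold P in *.
pose proof (divided _ _ _ _ w x wx Pw Px) as Dx.
pose proof (divided _ _ _ _ w y wy Pw Py) as Dy.
pose proof (divided _ _ _ _ w z wz Pw Pz) as Dz.
pose proof (divided (p1 + p2 * w + p3 * w ^ 2) (p2 + p3 * w) p3 0 x y xy
  ltac:(lra) ltac:(lra)) as Dxy.
pose proof (divided (p1 + p2 * w + p3 * w ^ 2) (p2 + p3 * w) p3 0 x z xz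
  ltac:(lra) ltac:(lra)) as Dxz.
assert (p3 = 0).
{ apply Rmult_eq_reg_l with (y - z); [lra | lra]. }
assert (p2 = 0) by (subst p3; lra).
assert (p1 = 0) by (subst p3 p2; lra).
assert (p0 = 0) by (subst p3 p2 p1; lra).
intros t; subst; ring.
Qed.

Theorem upper_bound a b c d : second_order_averaging_applies a b c d ->
  at_most 3 (bifurcating_limit_cycle a b c d).
Proof.
intros [H10 [rho [Hrho Hne]]] l Hl Hz.
pose proof (first_order_vanishes a b c d H10) as Hp.
destruct l as [| w [| x [| y [| z l]]]]; try (simpl; lia); exfalso.
assert (Z : forall r, In r (w :: x :: y :: z :: l) -> 0 < r /\
  coef0 a b c d + coef1 a b c d * (r ^ 2) + coef2 a b c d * (r ^ 2) ^ 2
   + coef3 a b c d * (r ^ 2) ^ 3 = 0).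
{ intros r Hr; destruct (Hz r Hr) as [Hr0 [E _]]; split; [exact Hr0 |].
  rewrite G20_cubic in E by assumption.
  apply Rmult_eq_reg_r with (/ r ^ 5); [| apply Rinv_neq_0_compat, pow_nonzero; lra].
  rewrite Rmult_0_l, <- E; unfold Rdiv; ring. }
assert (sq : forall r s, In r (w :: x :: y :: z :: l) -> In s (w :: x :: y :: z :: l) ->
  r <> s -> r ^ 2 <> s ^ 2).
{ intros r s Hr Hs Hrs E; apply Hrs; destruct (Z r Hr), (Z s Hs); nra. }
inversion_clear Hl as [| ? ? Nw H1]; inversion_clear H1 as [| ? ? Nx H2].
inversion_clear H2 as [| ? ? Ny _].
assert (E : coef0 a b c d + coef1 a b c d * (rho ^ 2) + coef2 a b c d * (rho ^ 2) ^ 2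
   + coef3 a b c d * (rho ^ 2) ^ 3 = 0).
{ apply (cubic_four_roots _ _ _ _ (w ^ 2) (x ^ 2) (y ^ 2) (z ^ 2));
    [apply sq .. | apply Z | apply Z | apply Z | apply Z];
    simpl in *; try tauto; intros ->; tauto. }
apply Hne; rewrite G20_cubic by assumption.
transitivity (0 / rho ^ 5); [f_equal; rewrite <- E; ring | field; lra].
Qed.

(** * Perturbations realizing every cubic *)

(** The constant part (alpha, 1) gives the coefficient of rho^0.  The quadratic part is chosen so that
its rescaled drift is the derivative of lambda exp (sin^2 theta) sin theta ([primitive_ex_2]): the
double integral in the coefficient of rho^2 becomes a single one.  The absence of linear and cubic
parts makes G10 vanish by parity alone. *)
Definition a_ex (alpha lambda : R) (i j : nat) : R :=
  match i, j with
  | 0%nat, 0%nat => alpha | 2%nat, 0%nat => lambda | 0%nat, 2%nat => - lambda | _, _ => 0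
  end.

Definition c_ex (lambda : R) (i j : nat) : R :=
  match i, j with
  | 0%nat, 0%nat => 1 | 1%nat, 1%nat => 2 * lambda | _, _ => 0
  end.

(** Radial vector fields: only the radial speed changes, with forcing of constant sign. *)
Definition b_ex (delta eta : R) (i j : nat) : R :=
  match i, j with
  | 1%nat, 0%nat => delta | 3%nat, 0%nat => eta | 1%nat, 2%nat => eta | _, _ => 0
  end.

Definition d_ex (delta eta : R) (i j : nat) : R :=
  match i, j with
  | 0%nat, 1%nat => delta | 2%nat, 1%nat => eta | 0%nat, 3%nat => eta | _, _ => 0
  end.

(** Equalities modulo cos^2 + sin^2 = 1; powers are unfolded because nsatz would otherwise take them
for unknowns. *)
Ltac trig t :=
  let H := fresh in
  pose proof (sin2_cos2 t) as H; unfold Rsqr in H;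
  generalize dependent (sin t); generalize dependent (cos t); intros; cbn [pow]; nsatz.

Ltac polar := unfold drift, radial, angular, form; simpl.

Ltac by_derivability := intros t; apply continuous_derivable; auto_derive; exact I.

Lemma angular_ex_0 alpha lambda t : angular (a_ex alpha lambda) (c_ex lambda) 0 t = cos t - alpha * sin t.
Proof. polar; ring. Qed.

Lemma drift_ex_0 alpha lambda t :
  drift (a_ex alpha lambda) (c_ex lambda) 0 t =
  alpha * cos t + sin t + 2 * cos t * sin t * (cos t - alpha * sin t).
Proof. polar; ring. Qed.

Lemma angular_ex_2 alpha lambda t : angular (a_ex alpha lambda) (c_ex lambda) 2 t = lambda * sin t.
Proof. polar; trig t. Qed.

Lemma drift_ex_2 alpha lambda t :
  drift (a_ex alpha lambda) (c_ex lambda) 2 t = lambda * cos t * (1 + 2 * sin t ^ 2).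
Proof. polar; trig t. Qed.

Lemma forcing_ex_1 alpha lambda t : forcing (a_ex alpha lambda) (c_ex lambda) 1 t = 0.
Proof. unfold forcing; polar; ring. Qed.

Lemma forcing_ex_3 alpha lambda t : forcing (a_ex alpha lambda) (c_ex lambda) 3 t = 0.
Proof. unfold forcing; polar; ring. Qed.

Lemma forcing_ex_bd_1 delta eta t :
  forcing (b_ex delta eta) (d_ex delta eta) 1 t = delta * exp (2 * sin t ^ 2).
Proof.
unfold forcing; rewrite Rmult_comm; f_equal; [polar; trig t | simpl; f_equal; ring].
Qed.

Lemma forcing_ex_bd_3 delta eta t : forcing (b_ex delta eta) (d_ex delta eta) 3 t = eta.
Proof.
unfold forcing; replace ((3 - INR 3) * sin t ^ 2) with 0 by (simpl; ring).
rewrite exp_0, Rmult_1_l; polar; trig t.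
Qed.

Lemma primitive_ex_2 alpha lambda t :
  forcing_primitive (a_ex alpha lambda) (c_ex lambda) 2 t = lambda * exp (sin t ^ 2) * sin t.
Proof.
unfold forcing_primitive.
rewrite (RInt_derivative (fun t => lambda * exp (sin t ^ 2) * sin t));
  [rewrite sin_0; ring | | apply continuous_forcing].
intros x; unfold forcing; rewrite drift_ex_2.
replace ((3 - INR 2) * sin x ^ 2) with (sin x ^ 2) by (simpl; ring).
auto_derive; [exact I | simpl; rewrite ?Rmult_1_r; ring].
Qed.

Lemma interaction_zero A C j k a b :
  (forall t, forcing A C k t = 0) -> RInt (interaction A C j k) a b = 0.
Proof. intros H; apply RInt_zero; intros t; unfold interaction; rewrite H; ring. Qed.

Lemma first_order_ex alpha lambda k : (k <= 3)%nat ->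
  forcing_primitive (a_ex alpha lambda) (c_ex lambda) k (2 * PI) = 0.
Proof.
intros Hk; destruct k as [| [| [| [| k]]]]; [ | | | | lia];
  try (apply primitive_2PI_even, Nat.even_spec; reflexivity); apply RInt_zero.
- apply forcing_ex_1.
- apply forcing_ex_3.
Qed.

(** The weights left in the four coefficients after exact differentials are removed; the one of
rho^6 is constant. *)
Definition kernel0 (t : R) : R := exp (6 * sin t ^ 2) * (cos t ^ 2 * sin t ^ 2).

Definition kernel1 (t : R) : R :=
  exp (4 * sin t ^ 2) * (1 + 2 * sin t ^ 2 + 8 * (cos t ^ 2 * sin t ^ 2)).

Definition kernel2 (t : R) : R := exp (2 * sin t ^ 2).

Lemma continuous_kernel0 t : continuous kernel0 t.
Proof. revert t; unfold kernel0; by_derivability. Qed.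

Lemma continuous_kernel1 t : continuous kernel1 t.
Proof. revert t; unfold kernel1; by_derivability. Qed.

Lemma continuous_kernel2 t : continuous kernel2 t.
Proof. revert t; unfold kernel2; by_derivability. Qed.

Lemma exp_ge_1 x : 0 <= x -> 1 <= exp x.
Proof. pose proof (exp_ineq1_le x); lra. Qed.

(** The kernel has zeros, at the multiples of pi / 2; it is at least cos^2 sin^2, whose primitive is
explicit. *)
Lemma RInt_kernel0_pos : 0 < RInt kernel0 0 (2 * PI).
Proof.
assert (cf : forall t, continuous (fun t => cos t ^ 2 * sin t ^ 2) t) by by_derivability.
pose proof PI_RGT_0 as HPI.
apply Rlt_le_trans with (RInt (fun t => cos t ^ 2 * sin t ^ 2) 0 (2 * PI)).
- rewrite (RInt_derivative
    (fun t => t / 8 - cos t * sin t * (cos t ^ 2 - sin t ^ 2) / 8)).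
  + rewrite sin_0, sin_2PI; lra.
  + intros t; auto_derive; [exact I |].
    pose proof (sin2_cos2 t) as H; unfold Rsqr in H.
    generalize dependent (sin t); generalize dependent (cos t); intros x y H.
    transitivity ((y * y + x * x) ^ 2 / 8 - ((x ^ 2 - y ^ 2) ^ 2 - 4 * x ^ 2 * y ^ 2) / 8);
      [rewrite H; field | field].
  + exact cf.
- apply RInt_le; [lra | now apply ex_RInt_everywhere | |].
  + apply ex_RInt_everywhere, continuous_kernel0.
  + intros t _; unfold kernel0.
    pose proof (pow2_ge_0 (sin t)); pose proof (exp_ge_1 (6 * sin t ^ 2) ltac:(nra)).
    assert (0 <= cos t ^ 2 * sin t ^ 2) by (apply Rmult_le_pos; apply pow2_ge_0); nra.
Qed.

Lemma RInt_kernel1_pos : 0 < RInt kernel1 0 (2 * PI).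
Proof.
pose proof PI_RGT_0 as HPI.
apply RInt_gt_0; [lra | | intros t _; apply continuous_kernel1].
intros t _; apply Rmult_lt_0_compat; [apply exp_pos |].
assert (0 <= cos t ^ 2 * sin t ^ 2) by (apply Rmult_le_pos; apply pow2_ge_0); nra.
Qed.

Lemma RInt_kernel2_pos : 0 < RInt kernel2 0 (2 * PI).
Proof.
pose proof PI_RGT_0 as HPI.
apply RInt_gt_0; [lra | intros t _; apply exp_pos | intros t _; apply continuous_kernel2].
Qed.

(** The integrand is - (M_0^2)' - E_0 Q_0.  In E_0 Q_0 the terms in 1 and alpha^2 are cos sin times a
function of sin^2, hence exact, with primitive exp (6 sin^2) times a linear function of sin^2.  For
the term in alpha, (exp (6 v) cos sin)' = exp (6 v) (cos^2 - sin^2 + 12 cos^2 sin^2) with v = sin^2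
turns exp (6 v) (cos^2 - sin^2 - 4 cos^2 sin^2) into - 16 exp (6 v) cos^2 sin^2. *)
Lemma coef0_ex alpha lambda delta eta :
  coef0 (a_ex alpha lambda) (b_ex delta eta) (c_ex lambda) (d_ex delta eta)
  = 16 * alpha * RInt kernel0 0 (2 * PI).
Proof.
unfold coef0; rewrite <- RInt_mult_l by apply continuous_kernel0.
set (M := forcing_primitive (a_ex alpha lambda) (c_ex lambda) 0).
apply (RInt_mod_exact _ _ (fun t => - M t ^ 2
  - exp (6 * sin t ^ 2) * (alpha * cos t * sin t
      + / 2 * (5 / 9 - sin t ^ 2 / 3) + / 2 * alpha ^ 2 * (sin t ^ 2 / 3 - 2 / 9)))).
- apply continuous_interaction.
- intros; apply continuous_mult_l, continuous_kernel0.
- intros t.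
  assert (dM := is_derive_primitive_forcing (a_ex alpha lambda) (c_ex lambda) 0 t); fold M in dM.
  auto_derive; [now exists (forcing (a_ex alpha lambda) (c_ex lambda) 0 t) |].
  replace (Derive (fun x => M x) t) with (forcing (a_ex alpha lambda) (c_ex lambda) 0 t)
    by (symmetry; now apply is_derive_unique).
  unfold interaction, kernel0, forcing, twist; fold M.
  rewrite drift_ex_0, angular_ex_0.
  replace (6 * (sin t * (sin t * 1))) with (6 * sin t ^ 2) by ring.
  rewrite (exp_INR_mult 6 _ 6), (exp_INR_mult (3 - INR 0) _ 3) by (simpl; ring).
  pose proof (sin2_cos2 t) as H; unfold Rsqr in H.
  generalize dependent (exp (sin t ^ 2)); generalize dependent (M t).
  generalize dependent (sin t); generalize dependent (cos t); simpl INR; intros.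
  (* nsatz works in a ring: the inverses become unknowns with their defining equations. *)
  assert (i2 : / 2 * 2 = 1) by field; assert (i3 : / 3 * 3 = 1) by field.
  unfold Rdiv; replace (/ 9) with (/ 3 * / 3) by field.
  generalize dependent (/ 2); generalize dependent (/ 3); intros.
  cbn [pow]; nsatz.
- cbv beta; rewrite sin_2PI, cos_2PI, sin_0, cos_0; unfold M.
  rewrite first_order_ex by lia.
  replace (forcing_primitive (a_ex alpha lambda) (c_ex lambda) 0 0) with 0; [ring |].
  symmetry; apply (@RInt_point R_CompleteNormedModule).
Qed.

(** With the explicit M_2, the terms in alpha are cos sin times a function of sin^2, hence exact; the
others add up to a sum of squares. *)
Lemma coef1_ex alpha lambda delta eta :
  coef1 (a_ex alpha lambda) (b_ex delta eta) (c_ex lambda) (d_ex delta eta)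
  = - lambda * RInt kernel1 0 (2 * PI).
Proof.
unfold coef1; rewrite (interaction_zero _ _ 1 1), Rplus_0_r by apply forcing_ex_1.
rewrite <- RInt_mult_l by apply continuous_kernel1.
rewrite <- RInt_add by apply continuous_interaction.
apply (RInt_mod_exact _ _
  (fun t => - lambda * alpha / 2 * (exp (4 * sin t ^ 2) * (1 - 2 * sin t ^ 2)))).
- intros; apply (continuous_plus (V := R_NormedModule)); apply continuous_interaction.
- intros; apply continuous_mult_l, continuous_kernel1.
- intros t; auto_derive; [exact I |].
  unfold interaction, kernel1, forcing, twist; rewrite primitive_ex_2.
  rewrite drift_ex_0, angular_ex_0, drift_ex_2, angular_ex_2.
  replace (4 * (sin t * (sin t * 1))) with (4 * sin t ^ 2) by ring.
  rewrite (exp_INR_mult (3 - INR 0) _ 3), (exp_INR_mult (3 - INR 2) _ 1),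
    (exp_INR_mult 4 _ 4) by (simpl; ring).
  pose proof (sin2_cos2 t) as H; unfold Rsqr in H.
  generalize dependent (exp (sin t ^ 2)).
  generalize dependent (sin t); generalize dependent (cos t); simpl INR; intros.
  assert (i2 : / 2 * 2 = 1) by field.
  unfold Rdiv; generalize dependent (/ 2); intros.
  generalize dependent (forcing_primitive (a_ex alpha lambda) (c_ex lambda) 0 t); intros.
  cbn [pow]; nsatz.
- cbv beta; rewrite sin_2PI, sin_0; reflexivity.
Qed.

Lemma coef2_ex alpha lambda delta eta :
  coef2 (a_ex alpha lambda) (b_ex delta eta) (c_ex lambda) (d_ex delta eta) = delta * RInt kernel2 0 (2 * PI).
Proof.
unfold coef2; rewrite (interaction_zero _ _ 1 3), (interaction_zero _ _ 3 1)
  by (apply forcing_ex_3 || apply forcing_ex_1).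
rewrite <- RInt_mult_l by apply continuous_kernel2.
replace (forcing_primitive _ _ 1 (2 * PI)) with (RInt (fun t => delta * kernel2 t) 0 (2 * PI))
  by (symmetry; apply RInt_eq; intros; apply forcing_ex_bd_1).
replace (RInt (interaction _ _ 2 2) 0 (2 * PI)) with 0; [ring | symmetry].
rewrite (RInt_derivative (fun t => - lambda ^ 2 / 2 * (exp (2 * sin t ^ 2) * sin t ^ 2))).
- rewrite sin_2PI, sin_0; ring.
- intros t; auto_derive; [exact I |].
  unfold interaction, forcing, twist; rewrite drift_ex_2, angular_ex_2.
  replace (2 * (sin t * (sin t * 1))) with (2 * sin t ^ 2) by ring.
  rewrite (exp_INR_mult 2 _ 2), (exp_INR_mult (3 - INR 2) _ 1) by (simpl; ring).
  simpl INR; field.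
- apply continuous_interaction.
Qed.

Lemma coef3_ex alpha lambda delta eta :
  coef3 (a_ex alpha lambda) (b_ex delta eta) (c_ex lambda) (d_ex delta eta) = eta * (2 * PI).
Proof.
unfold coef3; rewrite (interaction_zero _ _ 3 3) by apply forcing_ex_3.
unfold forcing_primitive; rewrite (RInt_eq _ (fun _ => eta)) by apply forcing_ex_bd_3.
rewrite (@RInt_const R_CompleteNormedModule); unfold scal; simpl; unfold mult; simpl; ring.
Qed.

Lemma realize_cubic (p0 p1 p2 p3 : R) :
  exists a b c d : nat -> nat -> R,
    (forall rho, 0 < rho -> G10 a b c d rho = 0) /\
    (forall rho, 0 < rho ->
       G20 a b c d rho = (p0 + p1 * rho ^ 2 + p2 * rho ^ 4 + p3 * rho ^ 6) / rho ^ 5).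
Proof.
pose proof RInt_kernel0_pos as K0; pose proof RInt_kernel1_pos as K1.
pose proof RInt_kernel2_pos as K2; pose proof PI_RGT_0 as HPI.
set (alpha := p0 / (16 * RInt kernel0 0 (2 * PI))).
set (lambda := - p1 / RInt kernel1 0 (2 * PI)).
set (delta := p2 / RInt kernel2 0 (2 * PI)).
set (eta := p3 / (2 * PI)).
exists (a_ex alpha lambda), (b_ex delta eta), (c_ex lambda), (d_ex delta eta); split; intros rho Hrho.
- rewrite G10_eq by exact Hrho; simpl sum_f_R0.
  rewrite !first_order_ex by lia; ring.
- rewrite G20_cubic by (apply first_order_ex || exact Hrho).
  rewrite coef0_ex, coef1_ex, coef2_ex, coef3_ex.
  unfold alpha, lambda, delta, eta; field; repeat split; lra.
Qed.

(** * Counting simple zeros *)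

(** At a zero of P the derivative of P / x^n is P' / x^n: the positive factor moves neither zeros
nor their simplicity. *)
Lemma simple_zero_iff (F P P' : R -> R) (n : nat) (r : R) :
  (forall x, 0 < x -> F x = P x / x ^ n) -> (forall x, is_derive P x (P' x)) -> 0 < r ->
  (F r = 0 /\ exists l, is_derive F r l /\ l <> 0) <-> (P r = 0 /\ P' r <> 0).
Proof.
intros HF dP Hr.
assert (Hn : r ^ n <> 0) by (apply pow_nonzero; lra).
assert (dF : P r = 0 -> is_derive F r (P' r / r ^ n)).
{ intros H0; apply is_derive_ext_loc with (fun x => P x / x ^ n).
  - generalize (locally_pos r Hr); apply filter_imp; intros x Hx; symmetry; now apply HF.
  - auto_derive; [split; [exists (P' r); apply dP | now split] |].
    replace (Derive (fun x => P x) r) with (P' r) by (symmetry; now apply is_derive_unique).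
    rewrite H0; field; exact Hn. }
assert (ZF : F r = 0 <-> P r = 0).
{ rewrite HF by exact Hr; split; intros H; [| rewrite H; field; exact Hn].
  apply Rmult_eq_reg_r with (/ r ^ n); [| now apply Rinv_neq_0_compat].
  rewrite Rmult_0_l; exact H. }
split.
- intros [H [l [dl Hl]]]; apply ZF in H; split; [exact H |].
  intros E; apply Hl; rewrite <- (is_derive_unique _ _ _ dl).
  rewrite (is_derive_unique _ _ _ (dF H)), E; apply Rmult_0_l.
- intros [H H']; split; [now apply ZF |].
  exists (P' r / r ^ n); split; [now apply dF |].
  apply Rmult_integral_contrapositive_currified; [exact H' | now apply Rinv_neq_0_compat].
Qed.

Lemma exactly_simple_zeros (k : nat) (p0 p1 p2 p3 : R) (l : list R) :
  NoDup l -> length l = k ->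
  (exists r, 0 < r /\ p0 + p1 * r ^ 2 + p2 * r ^ 4 + p3 * r ^ 6 <> 0) ->
  (forall r, In r l ->
     0 < r /\ p0 + p1 * r ^ 2 + p2 * r ^ 4 + p3 * r ^ 6 = 0 /\
     2 * p1 * r + 4 * p2 * r ^ 3 + 6 * p3 * r ^ 5 <> 0) ->
  (forall r, 0 < r -> p0 + p1 * r ^ 2 + p2 * r ^ 4 + p3 * r ^ 6 = 0 -> In r l) ->
  exists a b c d : nat -> nat -> R,
    second_order_averaging_applies a b c d /\
    exactly k (bifurcating_limit_cycle a b c d).
Proof.
intros Hl Hk [r1 [Hr1 Hne]] Hroots Hall.
destruct (realize_cubic p0 p1 p2 p3) as (a & b & c & d & H10 & H20).
exists a, b, c, d; split.
- split; [exact H10 | exists r1; split; [exact Hr1 |]].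
  rewrite H20 by exact Hr1; apply Rmult_integral_contrapositive_currified;
    [exact Hne | apply Rinv_neq_0_compat, pow_nonzero; lra].
- exists l; split; [exact Hl | split; [exact Hk |]]; intros r.
  unfold bifurcating_limit_cycle.
  pose proof (simple_zero_iff (G20 a b c d)
    (fun r => p0 + p1 * r ^ 2 + p2 * r ^ 4 + p3 * r ^ 6)
    (fun r => 2 * p1 * r + 4 * p2 * r ^ 3 + 6 * p3 * r ^ 5) 5 r H20) as Z.
  cbv beta in Z; split.
  + intros Hr; destruct (Hroots r Hr) as [Hr0 HP]; split; [exact Hr0 |].
    apply Z; [| exact Hr0 | exact HP]; intros x; auto_derive; [exact I | ring].
  + intros [Hr0 HF]; apply Hall; [exact Hr0 |].
    apply Z; [| exact Hr0 | exact HF]; intros x; auto_derive; [exact I | ring].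
Qed.

(** The roots in w = rho^2 are 1, 4, 9, so that the radii are 1, 2, 3. *)
Lemma examples (k : nat) : (k <= 3)%nat ->
  exists a b c d : nat -> nat -> R,
    second_order_averaging_applies a b c d /\
    exactly k (bifurcating_limit_cycle a b c d).
Proof.
intros Hk; destruct k as [| [| [| [| k]]]]; [ | | | | lia].
- apply (exactly_simple_zeros 0 1 0 0 0 nil); [constructor | reflexivity | | |].
  + exists 1; lra.
  + intros r [].
  + intros r _ H; lra.
- apply (exactly_simple_zeros 1 (-1) 1 0 0 (1 :: nil)); [| reflexivity | | |].
  + repeat constructor; intros [].
  + exists 2; lra.
  + intros r [<- | []]; lra.
  + intros r Hr H; left.
    assert (E : (r - 1) * (r + 1) = 0) by (rewrite <- H; ring).
    destruct (Rmult_integral _ _ E); lra.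
- apply (exactly_simple_zeros 2 4 (-5) 1 0 (1 :: 2 :: nil)); [| reflexivity | | |].
  + repeat constructor; simpl; intros H; decompose [or] H; lra.
  + exists 3; lra.
  + intros r [<- | [<- | []]]; lra.
  + intros r Hr H.
    assert (E : (r - 1) * (r + 1) * ((r - 2) * (r + 2)) = 0) by (rewrite <- H; ring).
    destruct (Rmult_integral _ _ E) as [E1 | E1]; destruct (Rmult_integral _ _ E1);
      simpl; lra.
- apply (exactly_simple_zeros 3 (-36) 49 (-14) 1 (1 :: 2 :: 3 :: nil));
    [| reflexivity | | |].
  + repeat constructor; simpl; intros H; decompose [or] H; lra.
  + exists 4; lra.
  + intros r [<- | [<- | [<- | []]]]; lra.
  + intros r Hr H.
    assert (E : (r - 1) * (r + 1) * ((r - 2) * (r + 2)) * ((r - 3) * (r + 3)) = 0)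
      by (rewrite <- H; ring).
    destruct (Rmult_integral _ _ E) as [E1 | E1];
      [destruct (Rmult_integral _ _ E1) as [E2 | E2]; destruct (Rmult_integral _ _ E2)
      | destruct (Rmult_integral _ _ E1)]; simpl; lra.
Qed.

Theorem theorem3 :
  global_center_at_origin X0 Y0 /\
  (forall a b c d : nat -> nat -> R,
     second_order_averaging_applies a b c d ->
     at_most 3 (bifurcating_limit_cycle a b c d)) /\
  (forall k : nat, (k <= 3)%nat ->
     exists a b c d : nat -> nat -> R,
       second_order_averaging_applies a b c d /\
       exactly k (bifurcating_limit_cycle a b c d)).
Proof.
exact (conj global_center (conj upper_bound examples)).
Qed.
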